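(* Let $g\in\mathbb{C}[x,y,z]_n$ be a non-zero homogeneous polynomial of degree $n$ defining a reduced curve in $\mathbb{P}^2$ that is not a set of concurrent lines, and suppose that $g$ has a linear Jacobian syzygy $(A,B,C)$. Then, up to a linear change of variables, one of the following two possibilities holds: 1. $A=ax$, $B=by$, $C=cz$ for some $a,b,c\in\mathbb{C}$ not all equal and with $a\neq 0$; 2. $A=y$, $B=z$, $C=0$.
   Context: A linear Jacobian syzygy of $g$ is a triple $(A,B,C)\neq(0,0,0)$ of linear forms in $\mathbb{C}[x,y,z]_1$ (each form is allowed to be zero, not all three) such that $A\,\partial_x g+B\,\partial_y g+C\,\partial_z g=0$. A set of concurrent lines is a union of lines all passing through a common point of $\mathbb{P}^2$. ''Up to a linear change of variables'' means the following. Write ${}^t(A,B,C)=H\cdot{}^t(x,y,z)$ with $H\in\mathbb{C}^{3\times 3}$. A linear change of variables $N\in GL(3,\mathbb{C})$ replaces $g$ by $g(N\cdot{}^t(x,y,z))$ and replaces the syzygy $(A,B,C)$ by the triple $N^{-1}HN\cdot{}^t(x,y,z)$, which is a linear Jacobian syzygy of the new polynomial. The assertion is that there is some $N\in GL(3,\mathbb{C})$ such that the new triple has form 1 or form 2. *)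

(* Defs.v *)
From HB Require Import structures.
From mathcomp Require Export all_boot all_order all_algebra.
From mathcomp Require Export reals complex.
From mathcomp Require Export mpoly.

Set Implicit Arguments.
Unset Strict Implicit.
Unset Printing Implicit Defensive.

Export GRing.Theory.
Local Open Scope ring_scope.

Section PlaneCurves.
Variable K : fieldType.
Implicit Types (g h q A B C : {mpoly K[3]}) (v p : 'rV[K]_3) (H : 'M[K]_3).

(* The indeterminates are numbered from 0: x = 'X_0, y = 'X_1, z = 'X_2. *)
Definition xyz : 'cV[{mpoly K[3]}]_3 := \col_(i < 3) 'X_i.

Definition triple A B C : 'cV[{mpoly K[3]}]_3 :=
  \col_(i < 3) [:: A; B; C]`_i.

Definition linear_triple H : 'cV[{mpoly K[3]}]_3 :=
  map_mx (@mpolyC 3 K) H *m xyz.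

(* The zero polynomial is d-homogeneous for every d, so each of the three
   forms may vanish. *)
Definition linear_jacobian_syzygy g A B C : Prop :=
  [/\ [/\ A \is 1.-homog, B \is 1.-homog & C \is 1.-homog],
      (A, B, C) <> (0, 0, 0)
    & A * g^`M(0) + B * g^`M(1) + C * g^`M(2) = 0].

(* The curve g = 0 has no multiple component: g is square-free. *)
Definition reduced g : Prop :=
  forall h q, g = q * h ^+ 2 -> h \is a GRing.unit.

(* Points of the projective plane are given by non-zero row vectors v; this is
   well defined on P^2 when g is homogeneous. *)
Definition on_curve g v : Prop := g.@[fun i => v 0 i] = 0.

(* The line with coefficient vector l <> 0 is the set of points v such that
   v *m l = 0. *)
Definition concurrent_lines g : Prop :=
  exists p : 'rV[K]_3, exists ls : seq 'cV[K]_3,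
    [/\ p != 0,
        (forall l, l \in ls -> l != 0 /\ p *m l = 0)
      & forall v, v != 0 ->
          (on_curve g v <-> exists2 l, l \in ls & v *m l = 0)].

End PlaneCurves.

Arguments xyz {K}.

(* Main.v *)
(** Write the syzygy as the linear vector field [D] with matrix [H], so that
[D g = 0], and put [H] in Jordan form. If [H] is diagonalizable with all
eigenvalues equal to [a], then [D] is [a] times the Euler field, so [a n g = 0]
and [a = 0], which is excluded since [H <> 0]; otherwise form 1 holds. If [H]
has a Jordan block of size exactly 2, the action of [D] on monomials forces [g]
to involve only two variables, and such a form cuts out concurrent lines. If
[H] is a single block with eigenvalue [a], a monomial of maximal weight in [g]
gives [a n = 0], which is form 2. *)
Require Import Defs.
From mathcomp Require Import fingroup perm.
From mathcomp Require Import zify ring.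
Import Num.Theory.
Set Implicit Arguments.
Unset Strict Implicit.
Unset Printing Implicit Defensive.
Local Open Scope ring_scope.

(** * Jordan forms of 3 x 3 matrices *)

(** One shape for all the Jordan types: eigenvalues on the diagonal, [e] and [f] in {0, 1} just
    above it, so that a single coefficient formula serves every case. *)
Definition bidiag3 (K : fieldType) (a b c e f : K) : 'M[K]_3 :=
  \matrix_(i < 3, j < 3)
    (nth [::] [:: [:: a; e; 0]; [:: 0; b; f]; [:: 0; 0; c]] i)`_j.

Lemma mulmx_rows3 (K : fieldType) m (u : 'rV[K]_3) (e : seq 'rV[K]_m) :
  u *m (\matrix_(i < 3) e`_i)
    = u 0 0 *: e`_0 + u 0 1 *: e`_1 + u 0 2 *: e`_2.
Proof.
rewrite mulmx_sum_row !big_ord_recl big_ord0 !rowK addr0 addrA.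
by congr (_ *: _ + u _ _ *: _ + u _ _ *: _); apply: val_inj.
Qed.


Lemma unitmx_rows3 (K : fieldType) (e0 e1 e2 : 'rV[K]_3) :
  (forall x y z, x *: e0 + y *: e1 + z *: e2 = 0 -> [/\ x = 0, y = 0 & z = 0]) ->
  \matrix_(i < 3) [:: e0; e1; e2]`_i \in unitmx.
Proof.
move=> free_e; rewrite -row_free_unit -kermx_eq0; apply/rowV0P => u.
rewrite sub_kermx mulmx_rows3 => /eqP /free_e[u0 u1 u2].
apply/rowP => j; rewrite mxE; case: j => [[|[|[|//]]] lt_j];
  [rewrite -[RHS]u0|rewrite -[RHS]u1|rewrite -[RHS]u2];
  by congr (u _ _); apply: val_inj.
Qed.

(** The [e_i] are the columns of [N], written as rows: [H *m N = N *m B] describes the images of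
    columns, whereas kernels, ranks and eigenvectors are formulated for rows. Hence the passage to
    [H^T]. *)
Lemma bidiag3_basis (K : fieldType) (H : 'M[K]_3) (a b c e f : K)
    (e0 e1 e2 : 'rV[K]_3) :
  (forall x y z, x *: e0 + y *: e1 + z *: e2 = 0 -> [/\ x = 0, y = 0 & z = 0]) ->
  e0 *m H^T = a *: e0 -> e1 *m H^T = e *: e0 + b *: e1 ->
  e2 *m H^T = f *: e1 + c *: e2 ->
  exists2 N, N \in unitmx & H *m N = N *m bidiag3 a b c e f.
Proof.
move=> /unitmx_rows3; set P := (\matrix_(_ < _) _) => unitP H0 H1 H2.
exists P^T; first by rewrite unitmx_tr.
apply: trmx_inj; rewrite !trmx_mul !trmxK.
apply/row_matrixP => i; rewrite !row_mul mulmx_rows3 rowK !mxE /=.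
by case: i => [[|[|[|//]]] lt_i] /=;
  rewrite ?H0 ?H1 ?H2 ?scale0r ?add0r ?addr0.
Qed.


Lemma mulmx_row_neq0 (K : fieldType) m n (B : 'M[K]_(m, n)) :
  B != 0 -> exists w : 'rV_m, w *m B != 0.
Proof. by case/rowV0Pn => v /submxP[w ->]; exists w. Qed.

Section Jordan.
Variables (K : fieldType) (H : 'M[K]_3) (a : K).
Let M : 'M[K]_3 := H^T - a%:M.

Let mulT (u : 'rV_3) : u *m H^T = u *m M + a *: u.
Proof. by rewrite mulmxBr mul_mx_scalar subrK. Qed.

(** Any [w] not killed by [M ^ 2] generates the Jordan chain [w M^2, w M, w]. *)
Lemma jordan3_nilpotent3 : M *m M *m M = 0 -> M *m M != 0 ->
  exists2 N, N \in unitmx & H *m N = N *m bidiag3 a a a 1 1.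
Proof.
move=> M3 /mulmx_row_neq0[w]; rewrite mulmxA => nzw.
have wM3 : w *m M *m M *m M = 0 by rewrite -[RHS](mulmx0 _ w) -M3 !mulmxA.
apply: (@bidiag3_basis _ _ _ _ _ _ _ (w *m M *m M) (w *m M) w).
- move=> x y z xyz0.
  (* Applying [M] twice to a linear relation leaves only its [w] term; applying [M] once then
     isolates the [w M] term. *)
  have z0 : z = 0.
    have /eqP := congr1 (fun u => u *m M *m M) xyz0.
    rewrite !mulmxDl -!scalemxAl !wM3 !mul0mx !scaler0 !add0r.
    by rewrite scaler_eq0 (negPf nzw) orbF => /eqP.
  have y0 : y = 0.
    have /eqP := congr1 (fun u => u *m M) xyz0.
    rewrite z0 scale0r addr0 mulmxDl -!scalemxAl !wM3 mul0mx scaler0 add0r.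
    by rewrite scaler_eq0 (negPf nzw) orbF => /eqP.
  split=> //; move: xyz0; rewrite y0 z0 !scale0r !addr0 => /eqP.
  by rewrite scaler_eq0 (negPf nzw) orbF => /eqP.
- by rewrite mulT wM3 add0r.
- by rewrite mulT scale1r.
- by rewrite mulT scale1r.
Qed.

(** Since the image of [M] lies in its kernel, [M] has rank at most 1 and its kernel has dimension
    at least 2. So a chain [w M, w] can be completed by a kernel vector [v] off the line of
    [w M]. *)
Lemma jordan3_nilpotent2 : M *m M = 0 -> M != 0 ->
  exists2 N, N \in unitmx & H *m N = N *m bidiag3 a a a 1 0.
Proof.
move=> M2 /mulmx_row_neq0[w nzw].
have wM2 : w *m M *m M = 0 by rewrite -mulmxA M2 mulmx0.
have rM : (\rank M <= 1)%N.
  have : (M <= kermx M)%MS by rewrite sub_kermx M2.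
  by move/mxrankS; rewrite mxrank_ker; lia.
have [v vM v_indep] : exists2 v : 'rV_3, v *m M = 0 & ~~ (v <= w *m M)%MS.
  have : ~~ (kermx M <= w *m M)%MS.
    apply: contraTN rM => /mxrankS; rewrite mxrank_ker rank_rV nzw; lia.
  case/row_subPn => i; exists (row i (kermx M)) => //.
  by rewrite -row_mul mulmx_ker row0.
apply: (@bidiag3_basis _ _ _ _ _ _ _ (w *m M) w v).
- move=> x y z xyz0.
  have y0 : y = 0.
    have /eqP := congr1 (fun u => u *m M) xyz0.
    rewrite !mulmxDl -!scalemxAl wM2 vM mul0mx !scaler0 add0r addr0.
    by rewrite scaler_eq0 (negPf nzw) orbF => /eqP.
  have z0 : z = 0.
    apply: contraNeq v_indep => nzz; move: xyz0.
    rewrite y0 scale0r addr0 addrC => /eqP; rewrite addr_eq0 => /eqP zv.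
    by rewrite -[v](scalerK nzz) zv -scaleNr !scalemx_sub.
  split=> //; move: xyz0; rewrite y0 z0 !scale0r !addr0 => /eqP.
  by rewrite scaler_eq0 (negPf nzw) orbF => /eqP.
- by rewrite mulT wM2 add0r.
- by rewrite mulT scale1r.
- by rewrite mulT vM scale0r.
Qed.

(** Multiplying by [Q = H^T - c] projects into the generalized eigenspace of [a]: as [Q] commutes
    with [M], [w = w' Q] is killed by [M^2], and [w'] is chosen so that [w M] is nonzero. The third
    vector is an eigenvector for [c], on which [M] acts by the nonzero scalar [c - a]. *)
Lemma jordan3_split c : c != a -> eigenvalue H^T c ->
    M *m M *m (H^T - c%:M) = 0 -> M *m (H^T - c%:M) != 0 ->
  exists2 N, N \in unitmx & H *m N = N *m bidiag3 a a c 1 0.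
Proof.
move=> neq_ca /eigenvalueP[v vH nzv] M2c /mulmx_row_neq0[w'].
set Q := H^T - c%:M.
have commMQ : M *m Q = Q *m M.
  have -> : Q = M + (a - c)%:M by rewrite raddfB addrA subrK.
  by rewrite (mulmxDr M M) (mulmxDl M _ M) scalar_mxC.
rewrite commMQ mulmxA; set w := w' *m Q => nzw.
have wM2 : w *m M *m M = 0.
  rewrite -[RHS](mulmx0 _ w') -M2c /w -(mulmxA w') -commMQ mulmxA.
  by rewrite -(mulmxA (w' *m M)) -commMQ !mulmxA.
have vM : v *m M = (c - a) *: v by rewrite mulmxBr vH mul_mx_scalar scalerBl.
have nz_ca : c - a != 0 by rewrite subr_eq0.
apply: (@bidiag3_basis _ _ _ _ _ _ _ (w *m M) w v).
- move=> x y z xyz0.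
  have z0 : z = 0.
    have /eqP := congr1 (fun u => u *m M *m M) xyz0.
    rewrite !mulmxDl -!scalemxAl wM2 !mul0mx !scaler0 !add0r vM -scalemxAl vM.
    by rewrite !scaler_eq0 (negPf nzv) (negPf nz_ca) !orbF => /eqP.
  have y0 : y = 0.
    have /eqP := congr1 (fun u => u *m M) xyz0.
    rewrite z0 scale0r addr0 !mulmxDl -!scalemxAl wM2 mul0mx scaler0 add0r.
    by rewrite scaler_eq0 (negPf nzw) orbF => /eqP.
  split=> //; move: xyz0; rewrite y0 z0 !scale0r !addr0 => /eqP.
  by rewrite scaler_eq0 (negPf nzw) orbF => /eqP.
- by rewrite mulT wM2 add0r.
- by rewrite mulT scale1r.
- by rewrite vH scale0r add0r.
Qed.

End Jordan.

Lemma diagonalizable3_basis (K : fieldType) (H : 'M[K]_3) :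
  diagonalizable H^T -> H != 0 ->
  exists a b c, a != 0 /\
    exists2 N, N \in unitmx & H *m N = N *m bidiag3 a b c 0 0.
Proof.
case=> P unitP /diagonalizable_forPex[d] /(simmxP unitP) PH nzH.
have HP : H *m P^T = P^T *m diag_mx d.
  by apply: trmx_inj; rewrite !trmx_mul trmxK PH tr_diag_mx.
have [k nzk] : exists k, d 0 k != 0.
  apply/existsP; apply: contraNT nzH => /existsPn d0.
  suff dm0 : diag_mx d = 0.
    have unitPT : P^T \in unitmx by rewrite unitmx_tr.
    by rewrite -(mulmxK unitPT H) HP dm0 mulmx0 mul0mx.
  suff -> : d = 0 by rewrite raddf0.
  by apply/rowP => k; rewrite mxE; apply/eqP; move: (d0 k); rewrite negbK.
(* A nonzero eigenvalue exists because [H] is nonzero; the transposition moves it to the first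
   position. *)
pose s := tperm 0 k.
exists (d 0 (s 0)), (d 0 (s 1)), (d 0 (s 2)); rewrite tpermL; split=> //.
exists (col_perm s P^T).
  by rewrite col_permE unitmx_mul unitmx_tr unitP unitmx_perm.
have -> : bidiag3 (d 0 k) (d 0 (s 1)) (d 0 (s 2)) 0 0
          = diag_mx (\row_j d 0 (s j)).
  apply/matrixP => i j; rewrite !mxE -(tpermL 0 k) -/s -val_eqE.
  by case: i j => [[|[|[|//]]] lt_i] [[|[|[|//]]] lt_j] //=;
    rewrite mulr1n; congr (d 0 (s _)); apply: val_inj.
apply/matrixP => i j; rewrite mul_mx_diag !mxE.
have := congr1 (fun A : 'M_3 => A i (s j)) HP.
rewrite mul_mx_diag !mxE => <-.
by apply: eq_bigr => l _; rewrite !mxE.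
Qed.

Lemma perm_dup (T : eqType) (s : seq T) :
  ~~ uniq s -> exists x t, perm_eq s [:: x, x & t].
Proof.
elim: s => //= x s IHs; rewrite negb_and negbK => /orP[s_x | /IHs[y [t s_t]]].
  by exists x, (rem x s); rewrite perm_cons perm_to_rem.
exists y, (x :: t); rewrite -(perm_cons x) in s_t.
by rewrite (perm_trans s_t) // (perm_catCA [:: x] [:: y; y] t).
Qed.

(** The roots of the minimal polynomial decide the type. Simple roots mean diagonalizable; otherwise
    some root [a] repeats, and the degree bound 3 leaves (X - a)^2 or (X - a)^2 (X - c), with [c]
    equal to [a] or not. *)
Lemma jordan3 (K : closedFieldType) (H : 'M[K]_3) : H != 0 ->
  exists a b c e f, exists N,
   [/\ N \in unitmx, H *m N = N *m bidiag3 a b c e f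
    & [\/ [/\ a != 0, e = 0 & f = 0], [/\ a = b, e = 1 & f = 0]
        | [/\ a = b, b = c, e = 1 & f = 1]]].
Proof.
move=> nzH; pose A := H^T.
have [rs def_p] := closed_field_poly_normal (mxminpoly A).
rewrite (monicP (mxminpoly_monic A)) scale1r in def_p.
have [uniq_rs|] := boolP (uniq rs).
  have /diagonalizable3_basis/(_ nzH) [a [b [c [nza [N unitN HN]]]]] :
      diagonalizable A.
    by apply/diagonalizableP; exists rs; rewrite // def_p.
  by exists a, b, c, 0, 0, N; split=> //; constructor 1.
(* No monic polynomial of degree below the minimal one annihilates [A]; this supplies the
   non-vanishing hypotheses of the Jordan lemmas. *)
have min_neq0 (q : {poly K}) :
    q \is monic -> (size q < size (mxminpoly A))%N -> horner_mx A q != 0.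
  move=> mon_q; apply: contraTneq => /mxminpoly_min /dvdp_leq.
  by rewrite monic_neq0 // -leqNgt; apply.
have le_rs : (size rs <= 3)%N.
  have := dvdp_leq (monic_neq0 (char_poly_monic A)) (mxminpoly_dvd_char A).
  by rewrite def_p size_prod_XsubC size_char_poly.
case/perm_dup=> a [s rs_s].
have size_min : size (mxminpoly A) = (size s).+3.
  by rewrite def_p size_prod_XsubC (perm_size rs_s).
rewrite (perm_big _ rs_s) !big_cons /= in def_p.
have hornerXB z : horner_mx A ('X - z%:P) = A - z%:M.
  by rewrite rmorphB /= horner_mx_X horner_mx_C.
have min0 := mx_root_minpoly A; rewrite def_p !rmorphM /= hornerXB in min0.
have le_s : (size s <= 1)%N by rewrite (perm_size rs_s) in le_rs.
have mon1 : 'X - a%:P \is monic by exact: monicXsubC.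
case: s => [|c [|//]] in rs_s def_p size_min min0 le_s *.
  have [||N unitN HN] := @jordan3_nilpotent2 _ H a.
  - by rewrite big_nil rmorph1 mulr1 in min0.
  - by rewrite -hornerXB min_neq0 // size_XsubC size_min.
  by exists a, a, a, 1, 0, N; split=> //; constructor 2.
rewrite big_seq1 hornerXB mulrA in min0.
have nz2 : horner_mx A (('X - a%:P) * ('X - c%:P)) != 0.
  rewrite min_neq0 ?rpredM ?monicXsubC //.
  by rewrite size_Mmonic ?polyXsubC_eq0 ?monicXsubC // !size_XsubC size_min.
rewrite rmorphM /= !hornerXB in nz2.
have [eq_ca | neq_ca] := eqVneq c a.
  rewrite eq_ca in min0 nz2.
  have [//|//|N unitN HN] := @jordan3_nilpotent3 _ H a.
  by exists a, a, a, 1, 1, N; split=> //; constructor 3.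
have eig_c : eigenvalue A c.
  by rewrite eigenvalue_root_min def_p big_seq1 !rootM !root_XsubC eqxx !orbT.
have [//|//|//|//|N unitN HN] := @jordan3_split _ H a c.
by exists a, a, c, 1, 0, N; split=> //; constructor 2.
Qed.

(** * Linear derivations and linear substitutions *)

(** Constants and variables generate the polynomial ring, so identities between derivations and ring
    morphisms need checking only on them. *)
Lemma mpoly_alg_ind n (K : fieldType) (P : {mpoly K[n]} -> Prop) :
  (forall c, P c%:MP) -> (forall i, P 'X_i) ->
  (forall p q, P p -> P q -> P (p + q)) ->
  (forall p q, P p -> P q -> P (p * q)) ->
  forall p, P p.
Proof.
move=> PC PX PD PM; elim/mpolyind=> [|c m p _ _ Pp]; first by rewrite -mpolyC0.
apply: (PD _ _ _ Pp); rewrite -mul_mpolyC mpolyXE_id; apply: (PM _ _ (PC c)).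
apply: (big_ind P) => //; first by rewrite -mpolyC1.
move=> i _; elim: (m i) => [|k IHk]; first by rewrite expr0 -mpolyC1.
by rewrite exprS; apply: PM.
Qed.

Section LinearDerivations.
Variables (K : fieldType) (n : nat).
Implicit Types (H N : 'M[K]_n) (p q : {mpoly K[n]}).

Definition lin_form H i : {mpoly K[n]} := \sum_j H i j *: 'X_j.

(** When the rows of [H] hold the coefficients of A, B and C, the syzygy reads
    [lin_deriv H g = 0]. *)
Definition lin_deriv H p : {mpoly K[n]} := \sum_i lin_form H i * p^`M(i).

Definition lin_subst N p : {mpoly K[n]} := p \mPo [tuple lin_form N i | i < n].

Lemma lin_derivC H c : lin_deriv H c%:MP = 0.
Proof. by rewrite /lin_deriv big1 // => i _; rewrite mderivC mulr0. Qed.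

Lemma lin_derivX H i : lin_deriv H 'X_i = lin_form H i.
Proof.
rewrite /lin_deriv (bigD1 i) //= big1 => [|j neq_ji].
  rewrite mderivX mnm1E eqxx scale1r -{1}[U_(i)%MM]add0m addmK mpolyX0.
  by rewrite mulr1 addr0.
by rewrite mderivX mnm1E eq_sym (negPf neq_ji) scale0r mulr0.
Qed.

Lemma lin_derivD H p q : lin_deriv H (p + q) = lin_deriv H p + lin_deriv H q.
Proof.
by rewrite -big_split; apply: eq_bigr => i _; rewrite mderivD mulrDr.
Qed.

Lemma lin_derivM H p q :
  lin_deriv H (p * q) = lin_deriv H p * q + p * lin_deriv H q.
Proof.
rewrite /lin_deriv [X in X + _]mulr_suml [X in _ + X]mulr_sumr -big_split.
by apply: eq_bigr => i _ /=; rewrite mderivM mulrDr !mulrA [p * _]mulrC.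
Qed.

Lemma lin_substX N i : lin_subst N 'X_i = lin_form N i.
Proof. by rewrite /lin_subst comp_mpolyXU -tnth_nth tnth_mktuple. Qed.

Lemma lin_subst_form N H i : lin_subst N (lin_form H i) = lin_form (H *m N) i.
Proof.
rewrite [LHS]linear_sum /= /lin_form.
under eq_bigr => j _ do rewrite comp_mpolyZ [_ \mPo _]lin_substX scaler_sumr.
rewrite exchange_big; apply: eq_bigr => k _ /=.
by rewrite mxE scaler_suml; apply: eq_bigr => j _; rewrite scalerA.
Qed.

Lemma lin_deriv_form N H i : lin_deriv H (lin_form N i) = lin_form (N *m H) i.
Proof.
have addD : {morph lin_deriv H : p q / p + q} by exact: lin_derivD.
rewrite [LHS](big_morph _ addD (lin_derivC H 0)).
have lin_derivZ c p : lin_deriv H (c *: p) = c *: lin_deriv H p.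
  by rewrite -!mul_mpolyC lin_derivM lin_derivC mul0r add0r.
under eq_bigr => j _ do rewrite lin_derivZ lin_derivX scaler_sumr.
rewrite exchange_big; apply: eq_bigr => k _ /=.
by rewrite mxE scaler_suml; apply: eq_bigr => j _; rewrite scalerA.
Qed.

Lemma lin_substK N : N \in unitmx -> cancel (lin_subst N) (lin_subst (invmx N)).
Proof.
move=> unitN p; elim/mpoly_alg_ind: p => [c|i|p q IHp IHq|p q IHp IHq].
- by rewrite /lin_subst !comp_mpolyC.
- rewrite lin_substX lin_subst_form mulmxV //.
  rewrite /lin_form (bigD1 i) //= mxE eqxx scale1r big1 ?addr0 // => j neq_ji.
  by rewrite mxE eq_sym (negPf neq_ji) scale0r.
- by rewrite /lin_subst !raddfD /= [_ \mPo _]IHp [_ \mPo _]IHq.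
- by rewrite /lin_subst !rmorphM /= [_ \mPo _]IHp [_ \mPo _]IHq.
Qed.

(* Both sides are derivations along [lin_subst N] that agree on the variables. *)
Lemma lin_deriv_subst N H H' p : N *m H' = H *m N ->
  lin_deriv H' (lin_subst N p) = lin_subst N (lin_deriv H p).
Proof.
move=> NH; elim/mpoly_alg_ind: p => [c|i|p q IHp IHq|p q IHp IHq].
- by rewrite /lin_subst lin_derivC comp_mpolyC lin_derivC comp_mpoly0.
- by rewrite lin_substX lin_derivX lin_deriv_form lin_subst_form NH.
- by rewrite lin_derivD /lin_subst !comp_mpolyD lin_derivD IHp IHq.
- by rewrite lin_derivM /lin_subst !(rmorphM, rmorphD) /= lin_derivM IHp IHq.
Qed.

Lemma meval_lin_subst N p (v : 'rV_n) :
  (lin_subst N p).@[v 0] = p.@[(v *m N^T) 0].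
Proof.
rewrite /lin_subst comp_mpoly_meval; apply: meval_eq => i.
rewrite tnth_mktuple [LHS]linear_sum mxE; apply: eq_bigr => j _.
by rewrite !mxE /= mevalZ mevalXU mulrC.
Qed.

End LinearDerivations.

(** * Coefficients of a derivation in Jordan form *)

(** The only monomial contributing to [m] is obtained from it by trading one x_j for one x_i. If
    [m j = 0] there is none, and the truncated [m - U_(j)] would be meaningless, hence the case
    distinction. *)
Lemma mcoeff_XMderiv (K : fieldType) n (i j : 'I_n) (p : {mpoly K[n]}) m :
  ('X_j * p^`M(i))@_m =
    if (0 < m j)%N then p@_(m - U_(j) + U_(i)) *+ ((m - U_(j))%MM i).+1 else 0.
Proof.
rewrite mulrC; case: ltnP => [gt0|].
  have /submK {1}<- : (U_(j) <= m)%MM by rewrite lep1mP -lt0n.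
  by rewrite addmC mcoeffMX mcoeff_deriv.
rewrite leqn0 => /eqP mj0; rewrite mcoeffM big1 // => k /eqP mk.
rewrite mcoeffX; case: eqP => [kj|]; last by rewrite mulr0.
move/(congr1 (fun m : 'X_{1..n} => m j)): mk.
by rewrite mj0 -kj mnmDE mnm1E eqxx addn1.
Qed.

Lemma mcoeff_XMderiv_diag (K : fieldType) n (i : 'I_n) (p : {mpoly K[n]}) m :
  ('X_i * p^`M(i))@_m = p@_m *+ m i.
Proof.
rewrite mcoeff_XMderiv; case: ltnP => [gt0|]; last by rewrite leqn0 => /eqP->.
by rewrite submK ?lep1mP -?lt0n // mnmBE mnm1E eqxx subn1 prednK.
Qed.

Lemma lin_form3 (K : fieldType) (H : 'M[K]_3) i :
  lin_form H i = H i 0 *: 'X_0 + H i 1 *: 'X_1 + H i 2 *: 'X_2.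
Proof.
rewrite /lin_form !big_ord_recl big_ord0 addr0 addrA.
by congr (_ + H i _ *: 'X_ _ + H i _ *: 'X_ _); apply: val_inj.
Qed.

Lemma lin_deriv3 (K : fieldType) (H : 'M[K]_3) p :
  lin_deriv H p = lin_form H 0 * p^`M(0) + lin_form H 1 * p^`M(1)
    + lin_form H 2 * p^`M(2).
Proof.
rewrite /lin_deriv !big_ord_recl big_ord0 addr0 addrA.
by congr (_ + lin_form H _ * p^`M( _) + lin_form H _ * p^`M( _));
  apply: val_inj.
Qed.

Lemma lin_form_bidiag (K : fieldType) (a b c e f : K) :
  [/\ lin_form (bidiag3 a b c e f) 0 = a *: 'X_0 + e *: 'X_1,
      lin_form (bidiag3 a b c e f) 1 = b *: 'X_1 + f *: 'X_2
    & lin_form (bidiag3 a b c e f) 2 = c *: 'X_2].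
Proof. by split; rewrite lin_form3 !mxE /= !scale0r ?addr0 ?add0r. Qed.

(** The diagonal part acts on each monomial by a scalar; only the nilpotent part mixes
    coefficients. *)
Lemma mcoeff_lin_deriv_bidiag (K : fieldType) (a b c e f : K) p m :
  (lin_deriv (bidiag3 a b c e f) p)@_m
  = (a *+ m 0 + b *+ m 1 + c *+ m 2) * p@_m
    + e * ('X_1 * p^`M(0))@_m + f * ('X_2 * p^`M(1))@_m.
Proof.
have [l0 l1 l2] := lin_form_bidiag a b c e f.
rewrite lin_deriv3 l0 l1 l2 !mulrDl -!scalerAl !mcoeffD !mcoeffZ.
rewrite !mcoeff_XMderiv_diag !mulrnAr !mulrnAl; ring.
Qed.

Lemma ord3P (i : 'I_3) : [\/ i = 0, i = 1 | i = 2].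
Proof.
by case: i => [[|[|[|//]]] lt_i]; [constructor 1|constructor 2|constructor 3];
  apply: val_inj.
Qed.

Lemma mdeg3 (m : 'X_{1..3}) : mdeg m = (m 0%R + m 1%R + m 2%R)%N.
Proof.
rewrite mdegE !big_ord_recl big_ord0 addn0 addnA.
by congr (_ + m _ + m _)%N; apply: val_inj.
Qed.

Lemma mpoly_max (K : fieldType) n (p : {mpoly K[n]}) (w : 'X_{1..n} -> nat) :
  p != 0 ->
  exists2 m, p@_m != 0 & forall k, p@_k != 0 -> (w k <= w m)%N.
Proof.
rewrite -msupp_eq0 => nzp.
suff [m p_m max_m]: exists2 m, m \in msupp p &
    forall k, k \in msupp p -> (w k <= w m)%N.
  by exists m => [|k]; rewrite -?mcoeff_msupp // => /max_m.
elim: (msupp p) nzp => // x [|y s] IHs _.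
  by exists x => [|k]; rewrite inE // => /eqP->.
have [//|m s_m max_m] := IHs; have [le_xm|lt_mx] := leqP (w x) (w m).
  exists m => [|k]; first by rewrite inE s_m orbT.
  by rewrite inE => /orP[/eqP->//|/max_m].
exists x => [|k]; first by rewrite inE eqxx.
by rewrite inE => /orP[/eqP->//|/max_m/leq_trans-> //]; apply: ltnW.
Qed.

(** * Forms annihilated by a derivation in Jordan form *)

Section KernelOfBidiag.
Variable K : numClosedFieldType.
Implicit Types (a b c : K) (g : {mpoly K[3]}).

(** By Euler's identity the derivation multiplies [g] by [a n]. The zero weight in [mpoly_max]
    merely picks some monomial of [g]. *)
Lemma scalar_syzygy a n g : (0 < n)%N -> g != 0 -> g \is n.-homog ->
  lin_deriv (bidiag3 a a a 0 0) g = 0 -> a = 0.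
Proof.
move=> n_gt0 nzg hom_g Dg0; have [m g_m _] := mpoly_max (fun=> 0%N) nzg.
have := congr1 (mcoeff m) Dg0.
rewrite mcoeff_lin_deriv_bidiag mcoeff0 !mul0r !addr0 -!mulrnDr -mdeg3.
rewrite (dhomog_mf hom_g) ?mcoeff_msupp // => /eqP.
by rewrite mulf_eq0 (negPf g_m) orbF mulrn_eq0 gtn_eqF //= => /eqP.
Qed.

(* The coefficient equation at a monomial of maximal weight 2 m_0 + m_1 only
   involves the eigenvalue, since the nilpotent part lowers the weight. *)
Lemma jordan_syzygy a n g : (0 < n)%N -> g != 0 -> g \is n.-homog ->
  lin_deriv (bidiag3 a a a 1 1) g = 0 -> a = 0.
Proof.
move=> n_gt0 nzg hom_g Dg0.
have [m g_m max_m] := mpoly_max (fun k : 'X_{1..3} => 2 * k 0%R + k 1%R)%N nzg.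
have coef0 (k : 'X_{1..3}) :
    (2 * m 0%R + m 1%R < 2 * k 0%R + k 1%R)%N -> g@_k = 0.
  by rewrite ltnNge; apply: contraNeq => /max_m.
have := congr1 (mcoeff m) Dg0.
rewrite mcoeff_lin_deriv_bidiag mcoeff0 !mul1r -!mulrnDr -mdeg3.
rewrite (dhomog_mf hom_g) ?mcoeff_msupp // !mcoeff_XMderiv.
(* Trading y for x, or z for y, raises the weight, so by maximality both contributing coefficients
   vanish. *)
rewrite (coef0 (m - U_(1%R) + U_(0%R))%MM) ?(coef0 (m - U_(2%R) + U_(1%R))%MM);
  rewrite ?mul0rn ?if_same ?addr0; last 2 first.
- by rewrite !(mnmDE, mnmBE, mnm1E) /=; lia.
- by rewrite !(mnmDE, mnmBE, mnm1E) /=; lia.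
by move/eqP; rewrite mulf_eq0 (negPf g_m) orbF mulrn_eq0 gtn_eqF //= => /eqP.
Qed.

(* At a monomial [m] of [g] with [m 0] maximal and positive, the coefficient
   equation makes the eigenvalue a m_0 + a m_1 + c m_2 vanish; replacing one x
   by y keeps this eigenvalue, and the equation there gives [g@_m = 0]. *)
Lemma split_syzygy a c g :
  lin_deriv (bidiag3 a a c 1 0) g = 0 -> forall m, g@_m != 0 -> m 0 = 0%N.
Proof.
move=> Dg0 m0 g_m0.
have nzg : g != 0 by apply: contraNneq g_m0 => ->; rewrite mcoeff0.
have [m g_m max_m] := mpoly_max (fun k : 'X_{1..3} => k 0) nzg.
apply/eqP; rewrite -leqn0; apply: leq_trans (max_m _ g_m0) _.
rewrite leqNgt; apply/negP => m_gt0.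
have Dcoef (k : 'X_{1..3}) :
      (a *+ k 0 + a *+ k 1 + c *+ k 2) * g@_k
        + ('X_1 * g^`M(0))@_k = 0.
  have := congr1 (mcoeff k) Dg0.
  by rewrite mcoeff_lin_deriv_bidiag mcoeff0 mul1r mul0r addr0.
have w0 : a *+ m 0 + a *+ m 1 + c *+ m 2 = 0.
  apply/eqP; have /eqP := Dcoef m; rewrite mcoeff_XMderiv.
  (* The exponent of x here is [m 0 + 1], beyond the maximum. *)
  suff -> : g@_(m - U_(1%R) + U_(0%R)) = 0.
    by rewrite mul0rn if_same addr0 mulf_eq0 (negPf g_m) orbF.
  apply/eqP; apply: contraTT isT => /max_m.
  by rewrite !(mnmDE, mnmBE, mnm1E) /=; lia.
have U0m : (U_(0%R) <= m)%MM by rewrite lep1mP -lt0n.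
have := Dcoef (m - U_(0%R) + U_(1%R))%MM.
rewrite mcoeff_XMderiv addmK submK //.
rewrite !(mnmDE, mnmBE, mnm1E) /= !subn0 !addn0 addn1 /= subn1 prednK //.
rewrite (_ : _ + _ + _ = a *+ m 0 + a *+ m 1 + c *+ m 2); last first.
  by rewrite -!mulrnDr addnS -addSn prednK.
by rewrite w0 mul0r add0r => /eqP; rewrite mulrn_eq0 (negPf g_m) orbF gtn_eqF.
Qed.

(** * Binary forms cut out concurrent lines *)

Lemma binary_expansion n g : g \is n.-homog ->
  (forall m, g@_m != 0 -> m 0 = 0%N) ->
  exists c : nat -> K, g = \sum_(k < n.+1) c k *: ('X_1 ^+ (n - k) * 'X_2 ^+ k).
Proof.
move=> hom_g g_yz.
pose mon k : 'X_{1..3} := (U_(1%R) *+ (n - k) + U_(2%R) *+ k)%MM.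
have monE k : [/\ mon k 0 = 0%N, mon k 1 = (n - k)%N & mon k 2 = k].
  split; rewrite /mon mnmDE !mulmnE !mnm1E /=;
    by rewrite ?muln0 ?muln1 ?mul1n ?mul0n ?addn0.
exists (fun k => g@_(mon k)).
under eq_bigr => k _ do rewrite !mpolyXn -mpolyXD.
apply/mpolyP => m; rewrite linear_sum /=.
have [g_m0 | g_m] := eqVneq g@_m 0.
  rewrite g_m0 big1 // => k _; rewrite mcoeffZ mcoeffX -/(mon k).
  by case: eqP => [->|_]; rewrite ?g_m0 ?mul0r ?mulr0.
have m0 := g_yz m g_m.
have deg_m : (m 1%R + m 2%R)%N = n.
  transitivity (mdeg m); first by rewrite mdeg3 m0.
  by apply: (dhomog_mf hom_g); rewrite mcoeff_msupp.
have m_mon : mon (m 2) = m.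
  have [e0 e1 e2] := monE (m 2); apply/mnmP => i.
  by case: (ord3P i) => ->; rewrite ?e0 ?e1 ?e2 //; lia.
have lt_m2 : (m 2%R < n.+1)%N by lia.
rewrite (bigD1 (Ordinal lt_m2)) //= mcoeffZ mcoeffX -/(mon (m 2)) m_mon eqxx.
rewrite mulr1 big1 ?addr0 // => k neq_km; rewrite mcoeffZ mcoeffX -/(mon k).
case: eqP => [mon_k|]; last by rewrite mulr0.
case/eqP: neq_km; apply: val_inj; rewrite /= -mon_k.
by have [_ _ ->] := monE k.
Qed.

(** Where y is nonzero, [g] equals y^n Q(z/y), so each root r of [Q] gives the line z = r y. All
    these lines, and y = 0, pass through (1 : 0 : 0). *)
Lemma concurrent_binary n g : (0 < n)%N -> g != 0 -> g \is n.-homog ->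
  (forall m, g@_m != 0 -> m 0 = 0%N) -> concurrent_lines g.
Proof.
move=> n_gt0 nzg hom_g /(binary_expansion hom_g)[c def_g].
pose Q := \poly_(k < n.+1) c k.
have g_eval (v : 'rV_3) :
    g.@[v 0] = \sum_(k < n.+1) c k * (v 0 1 ^+ (n - k) * v 0 2 ^+ k).
  rewrite def_g linear_sum; apply: eq_bigr => k _ /=.
  by rewrite mevalZ mevalM !rmorphXn /= !mevalXU.
have g_eval0 (v : 'rV_3) : v 0 1 = 0 -> g.@[v 0] = c n * v 0 2 ^+ n.
  move=> v1; rewrite g_eval big_ord_recr /= subnn mul1r big1 ?add0r // => k _.
  by rewrite v1 expr0n subn_eq0 leqNgt ltn_ord mul0r mulr0.
have g_evalQ (v : 'rV_3) : 
    v 0 1 != 0 -> g.@[v 0] = v 0 1 ^+ n * Q.[v 0 2 / v 0 1].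
  move=> nzv1; rewrite g_eval horner_poly mulr_sumr; apply: eq_bigr => k _.
  rewrite [RHS]mulrCA expr_div_n; congr (_ * _).
  rewrite [RHS]mulrCA [RHS]mulrC.
  by rewrite -expfB_cond ?(negPf nzv1) ?add0n // -ltnS.
have nzQ : Q != 0.
  apply: contraNneq nzg => Q0; rewrite def_g big1 // => k _.
  have := congr1 (fun q : {poly K} => q`_k) Q0.
  by rewrite coef_poly ltn_ord coef0 => ->; rewrite scale0r.
have [rs def_Q] := closed_field_poly_normal Q.
have rootQ r : (Q.[r] == 0) = (r \in rs).
  rewrite -rootE def_Q rootZ ?lead_coef_eq0 //; exact: root_prod_XsubC.
pose line r : 'cV[K]_3 := \col_(i < 3) [:: 0; - r; 1]`_i.
(* The line y = 0 is a component exactly when the coefficient of z^n vanishes, that is, when [Q] has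
   degree below [n]. *)
pose ls := [seq line r | r <- rs] ++
  if c n == 0 then [:: delta_mx 1 0] else [::].
have mul_line (v : 'rV_3) r : (v *m line r) 0 0 = v 0 2 - r * v 0 1.
  rewrite mxE !big_ord_recl big_ord0 !mxE /= mulr0 mulr1 add0r addr0 addrC.
  rewrite mulrN mulrC.
  by congr (v _ _ - _ * v _ _); apply: val_inj.
have mul_e1 (v : 'rV_3) : (v *m delta_mx 1 (0 : 'I_1)) 0 0 = v 0 1.
  by rewrite -colE mxE.
have mx11 (x : 'M[K]_1) : x 0 0 = 0 -> x = 0.
  by move=> x0; apply/matrixP => i j; rewrite !ord1 mxE.
have rs_ls r : r \in rs -> line r \in ls by move=> rs_r; rewrite mem_cat map_f.
exists (delta_mx 0 0), ls; split=> [|l|v nzv].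
- by apply/rV0Pn; exists 0; rewrite mxE !eqxx oner_eq0.
- rewrite mem_cat => /orP[/mapP[r _ ->]|].
    split; last by apply: mx11; rewrite mul_line !mxE /= mulr0 subr0.
    apply/eqP=> /matrixP/(_ 2 0); rewrite !mxE /=; exact/eqP/oner_neq0.
  case: ifP => // _; rewrite inE => /eqP->.
  split; last by apply: mx11; rewrite mul_e1 mxE.
  apply/eqP=> /matrixP/(_ 1 0); rewrite !mxE /=; exact/eqP/oner_neq0.
rewrite /on_curve -/(g.@[v 0]); have [v1 | nzv1] := eqVneq (v 0 1) 0.
  rewrite g_eval0 //; split=> [/eqP|[l]].
    have [v2 _|nzv2] := eqVneq (v 0 2) 0; last first.
      rewrite mulf_eq0 expf_eq0 (negPf nzv2) andbF orbF => cn0.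
      exists (delta_mx 1 0); first by rewrite mem_cat cn0 inE eqxx orbT.
      by apply: mx11; rewrite mul_e1.
    (* Here [v] is the common point itself, so any line will do, but one must exist: if [c n] is
       nonzero, [Q] has degree [n > 0] and hence a root. *)
    have [cn0|nz_cn] := boolP (c n == 0).
      exists (delta_mx 1 0); first by rewrite mem_cat cn0 inE eqxx orbT.
      by apply: mx11; rewrite mul_e1.
    have : (1 < size Q)%N by rewrite size_poly_eq.
    rewrite def_Q size_scale ?lead_coef_eq0 // size_prod_XsubC.
    case def_rs: rs => [//|r t] _.
    exists (line r); first by rewrite rs_ls // def_rs inE eqxx.
    by apply: mx11; rewrite mul_line v1 v2 mulr0 subr0.
  rewrite mem_cat => /orP[/mapP[r _ ->] /matrixP/(_ 0 0)|].
    rewrite mul_line v1 mulr0 subr0 mxE => ->.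
    by rewrite expr0n gtn_eqF // mulr0.
  by case: ifP => // /eqP-> _ _; rewrite mul0r.
rewrite g_evalQ //; split=> [/eqP|[l]].
  rewrite mulf_eq0 expf_eq0 (negPf nzv1) andbF /= rootQ => /rs_ls ls_l.
  exists (line (v 0 2 / v 0 1)) => //.
  by apply: mx11; rewrite mul_line divfK ?subrr.
rewrite mem_cat => /orP[/mapP[r rs_r ->] /matrixP/(_ 0 0)|].
  rewrite mul_line mxE => /eqP; rewrite subr_eq0 => /eqP->.
  by rewrite mulfK //; move: rs_r; rewrite -rootQ => /eqP->; rewrite mulr0.
case: ifP => // _; rewrite inE => /eqP-> /matrixP/(_ 0 0).
by rewrite mul_e1 mxE => v1; rewrite v1 eqxx in nzv1.
Qed.

End KernelOfBidiag.

(** * Invariance under linear changes of variables *)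

(** The Euler field scales each monomial by its degree, and in characteristic zero this scalar
    determines the degree. Since the matrix of the field is the identity, it commutes with every
    substitution, which makes homogeneity invariant. *)
Lemma euler_homogP (K : numFieldType) n (p : {mpoly K[3]}) :
  reflect (lin_deriv (bidiag3 1 1 1 0 0) p = p *+ n) (p \is n.-homog).
Proof.
have coefE m : (lin_deriv (bidiag3 1 1 1 0 0) p)@_m = p@_m *+ mdeg m.
  rewrite mcoeff_lin_deriv_bidiag !mul0r !addr0 -!mulrnDr -mdeg3.
  by rewrite mulr_natl.
apply: (iffP idP) => [hom_p|Ep].
  apply/mpolyP=> m; rewrite coefE mcoeffMn.
  have [->|p_m] := eqVneq p@_m 0; first by rewrite !mul0rn.
  by congr (_ *+ _); apply: (dhomog_mf hom_p); rewrite mcoeff_msupp.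
apply/dhomogP => m; rewrite mcoeff_msupp => p_m.
have := congr1 (mcoeff m) Ep; rewrite coefE mcoeffMn -mulr_natr.
by rewrite -[RHS]mulr_natr => /(mulfI p_m)/eqP; rewrite eqr_nat => /eqP.
Qed.

Lemma bidiag3_scalar (K : fieldType) (a : K) : bidiag3 a a a 0 0 = a%:M.
Proof.
apply/matrixP => i j; rewrite !mxE -val_eqE.
by case: i j => [[|[|[|//]]] lt_i] [[|[|[|//]]] lt_j].
Qed.

Lemma lin_subst_homog (K : numFieldType) n (N : 'M[K]_3) p :
  p \is n.-homog -> lin_subst N p \is n.-homog.
Proof.
move/euler_homogP => Ep; apply/euler_homogP; rewrite bidiag3_scalar in Ep *.
rewrite (lin_deriv_subst _ (H := 1%:M)) ?mulmx1 ?mul1mx // Ep.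
by rewrite /lin_subst raddfMn.
Qed.

(** The map v -> v N^T carries the curve of [lin_subst N p] to that of [p]. Points move by [N^T] and
    line coefficients by its inverse, which preserves incidence. *)
Lemma concurrent_lines_subst (K : fieldType) (N : 'M[K]_3) p :
  N \in unitmx -> concurrent_lines (lin_subst N p) -> concurrent_lines p.
Proof.
move=> unitN [x [ls [nzx ls_x on_ls]]].
have unitT : N^T \in unitmx by rewrite unitmx_tr.
have neq0 m (w : 'M_(m, 3)) : w != 0 -> w *m N^T != 0.
  by apply: contraNneq => wN; rewrite -[w](mulmxK unitT) wN mul0mx.
exists (x *m N^T), [seq invmx N^T *m l | l <- ls].
split=> [|_ /mapP[l /ls_x[nzl xl] ->]|v nzv]; first exact: neq0.
  split; last by rewrite mulmxA mulmxK.
  by apply: contraNneq nzl => Nl; rewrite -[l](mulKVmx unitT) Nl mulmx0.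
have v'K : v *m invmx N^T *m N^T = v by rewrite mulmxKV.
have nzv' : v *m invmx N^T != 0.
  by apply: contraNneq nzv => v'0; rewrite -v'K v'0 mul0mx.
have := on_ls _ nzv'; rewrite /on_curve.
rewrite (meval_lin_subst N p (v *m invmx N^T)) v'K => ->.
split=> [[l ls_l vl] | [_ /mapP[l ls_l ->]]]; last first.
  by rewrite mulmxA => vl; exists l.
by exists (invmx N^T *m l); rewrite ?map_f // mulmxA.
Qed.

(** * From matrices to triples of linear forms, and the classification *)

Lemma linear_tripleE (K : fieldType) (H : 'M[K]_3) i j :
  linear_triple H i j = lin_form H i.
Proof.
rewrite mxE; apply: eq_bigr => k _.
by rewrite !mxE mul_mpolyC.
Qed.

Lemma tripleP (K : fieldType) (H : 'M[K]_3) (A B C : {mpoly K[3]}) :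
  lin_form H 0 = A -> lin_form H 1 = B -> lin_form H 2 = C ->
  linear_triple H = triple A B C.
Proof.
move=> HA HB HC; apply/matrixP => i j; rewrite linear_tripleE mxE.
by case: (ord3P i) => ->.
Qed.

Lemma lin_form_coef (K : fieldType) (H : 'M[K]_3) (p : {mpoly K[3]}) i :
  p \is 1.-homog -> (forall j, H i j = p@_U_(j)) -> lin_form H i = p.
Proof.
move=> hom_p Hp; apply/mpolyP => m; rewrite linear_sum /=.
have [m1|m_neq1] := eqVneq (mdeg m) 1%N; last first.
  rewrite (dhomog_nemf_coeff hom_p) // big1 // => j _.
  rewrite mcoeffZ mcoeffX; case: eqP => [mj|]; last by rewrite mulr0.
  by rewrite -mj mdeg1 eqxx in m_neq1.
have /mdeg1P[j /eqP->] : mdeg m == 1%N by apply/eqP.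
rewrite (bigD1 j) //= mcoeffZ mcoeffXU eqxx mulr1 Hp big1 ?addr0 // => k neq_kj.
by rewrite mcoeffZ mcoeffXU (negPf neq_kj) mulr0.
Qed.

Theorem proposition3p5 (R : realType) (n : nat) (g A B C : {mpoly R[i][3]}) :
  (0 < n)%N -> g != 0 -> g \is n.-homog ->
  reduced g -> ~ concurrent_lines g ->
  linear_jacobian_syzygy g A B C ->
  exists N H : 'M[R[i]]_3,
    [/\ N \in unitmx,
        triple A B C = linear_triple H
      & (exists a b c : R[i],
           [/\ ~ (a = b /\ b = c),
               a != 0
             & linear_triple (invmx N *m H *m N)
               = triple (a *: 'X_0) (b *: 'X_1) (c *: 'X_2)])
        \/ linear_triple (invmx N *m H *m N) = triple 'X_1 'X_2 0].
Proof.
move=> n_gt0 nzg hom_g _ not_conc [[homA homB homC] nzABC syz].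
pose H : 'M[R[i]]_3 := \matrix_(i, j) ([:: A; B; C]`_i)@_U_(j).
have HA : lin_form H 0 = A by apply: lin_form_coef => // j; rewrite mxE.
have HB : lin_form H 1 = B by apply: lin_form_coef => // j; rewrite mxE.
have HC : lin_form H 2 = C by apply: lin_form_coef => // j; rewrite mxE.
have nzH : H != 0.
  apply/eqP => H0; case: nzABC; rewrite -HA -HB -HC H0 !lin_form3 !mxE.
  by rewrite !scale0r !addr0.
have Dg : lin_deriv H g = 0 by rewrite lin_deriv3 HA HB HC.
have [a [b [c [e [f [N [unitN HN cases]]]]]]] := jordan3 nzH.
have HN' : invmx N *m H *m N = bidiag3 a b c e f.
  by rewrite -mulmxA HN mulKmx.
exists N, H; split=> //; first by rewrite (tripleP HA HB HC).
pose g' := lin_subst N g.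
have Dg' : lin_deriv (bidiag3 a b c e f) g' = 0.
  by rewrite (lin_deriv_subst _ (esym HN)) Dg /lin_subst raddf0.
have hom_g' : g' \is n.-homog by apply: lin_subst_homog.
have nzg' : g' != 0.
  apply: contraNneq nzg => g'0.
  by rewrite -(lin_substK unitN g) -/g' g'0 /lin_subst raddf0.
have [l0 l1 l2] := lin_form_bidiag a b c e f.
rewrite HN' (tripleP l0 l1 l2).
case: cases => [[nza e0 f0]|[eq_ab e1 f0]|[eq_ab eq_bc e1 f1]].
- rewrite e0 f0 in Dg' *; left; exists a, b, c.
  split=> //; last by rewrite !scale0r !addr0.
  (* Three equal eigenvalues would give a multiple of the Euler field, forcing [a = 0]. *)
  case=> eq_ab eq_bc; rewrite -eq_bc -eq_ab in Dg'; case/eqP: nza.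
  exact: scalar_syzygy n_gt0 nzg' hom_g' Dg'.
(* Here [c] may or may not equal [a]; in both cases [g'] is free of x, so its curve, and with it
   that of [g], is a set of concurrent lines. *)
- rewrite -eq_ab e1 f0 in Dg'.
  case: not_conc; apply: (concurrent_lines_subst unitN).
  exact: concurrent_binary n_gt0 nzg' hom_g' (split_syzygy Dg').
(* With a single block the eigenvalue is 0, which leaves exactly the triple (y, z, 0). *)
rewrite -eq_bc -eq_ab e1 f1 in Dg' *.
right; rewrite (jordan_syzygy n_gt0 nzg' hom_g' Dg').
by rewrite !scale0r !scale1r !add0r.
Qed.
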